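(* Let $k\ge 2$ and let $G$ be a connected $k$-uniform hypergraph (with at least one edge) on $n$ vertices with maximum degree $\Delta$ and minimum degree $\delta$, and let $x=(x_1,\dots,x_n)^{\mathrm T}$ be the principal eigenvector of $G$, with maximum entry $x_{\max}$ and minimum entry $x_{\min}$. Then (1) $\displaystyle x_{\max}\ge\left[\left(\frac{\delta}{\Delta}\right)^{\frac{k}{2(k-1)}}+n-1\right]^{-\frac1k}$; (2) $\displaystyle x_{\min}\le\left[\left(\frac{\Delta}{\delta}\right)^{\frac{k}{2(k-1)}}+n-1\right]^{-\frac1k}$.
   Context: A $k$-uniform hypergraph $G$ has a finite vertex set $V(G)=\{1,\dots,n\}$ and a set $E(G)$ of edges, each of which is a set of exactly $k$ distinct vertices. The degree $d_i$ of a vertex $i$ is the number of edges containing $i$; $\Delta=\max_i d_i$, $\delta=\min_i d_i$. A path from $u$ to $v$ is an alternating sequence $v_0e_1v_1e_2\cdots v_{l-1}e_lv_l$ with $v_0=u$, $v_l=v$, where the vertices $v_0,\dots,v_l$ are distinct, the edges $e_1,\dots,e_l$ are distinct, and $v_{i-1},v_i\in e_i$ for $i=1,\dots,l$; $G$ is connected if there is a path between any two vertices. The adjacency tensor of $G$ is $\mathcal{A}_G=(a_{i_1\cdots i_k})$, of order $k$ and dimension $n$, with $a_{i_1\cdots i_k}=\frac{1}{(k-1)!}$ if $\{i_1,\dots,i_k\}\in E(G)$ and $a_{i_1\cdots i_k}=0$ otherwise. For $x\in\mathbb{C}^n$, $\mathcal{A}_Gx^{k-1}\in\mathbb{C}^n$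 has $i$-th component $\sum_{i_2,\dots,i_k=1}^n a_{ii_2\cdots i_k}x_{i_2}\cdots x_{i_k}$. A number $\lambda\in\mathbb{C}$ is an eigenvalue of $\mathcal{A}_G$ with eigenvector $x\in\mathbb{C}^n\setminus\{0\}$ if $\mathcal{A}_Gx^{k-1}=\lambda x^{[k-1]}$, where $x^{[k-1]}=(x_1^{k-1},\dots,x_n^{k-1})^{\mathrm T}$. The spectral radius $\rho(G)$ is the maximum modulus of the eigenvalues of $\mathcal{A}_G$. For $G$ connected, by the Perron–Frobenius theorem for nonnegative weakly irreducible tensors, $\rho(G)$ is an eigenvalue and there is a unique eigenvector $x=(x_1,\dots,x_n)^{\mathrm T}$ for $\rho(G)$ with all entries positive and $\sum_{i=1}^n x_i^k=1$; it is called the principal eigenvector of $G$. Write $x_{\max}=\max_i x_i$, $x_{\min}=\min_i x_i$. *)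

(* Defs.v *)
From HB Require Import structures.
From mathcomp Require Import all_boot all_order all_algebra.
From mathcomp Require Import all_classical all_reals all_analysis.
From mathcomp Require Import complex.

Set Implicit Arguments.
Unset Strict Implicit.
Unset Printing Implicit Defensive.

Import Order.TTheory GRing.Theory Num.Theory.
Local Open Scope classical_set_scope.
Local Open Scope ring_scope.
Local Open Scope complex_scope.

Record hypergraph (n k : nat) := Hypergraph {
  edges : {set {set 'I_n}};
  edges_uniform : forall e, e \in edges -> #|e| = k
}.

Section Hypergraph.
Variables (n k : nat) (G : hypergraph n k).

Definition degree (i : 'I_n) : nat := #|[set e in edges G | i \in e]|.

Definition max_degree : nat := \max_(i < n) degree i.

(* Every degree is at most #|edges G|, so for 0 < n the default value of the
   iterated minimum plays no role. *)
Definition min_degree : nat := \big[minn/#|edges G|]_(i < n) degree i.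

(* The sequence u e_1 v_1 ... e_l v_l is encoded by its starting vertex u and
   the list p = [:: (e_1, v_1); ...; (e_l, v_l)]. *)
Fixpoint hwalk (u : 'I_n) (p : seq ({set 'I_n} * 'I_n)) : bool :=
  if p is (e, v) :: p' then
    [&& e \in edges G, u \in e, v \in e & hwalk v p']
  else true.

Definition hpath (u : 'I_n) (p : seq ({set 'I_n} * 'I_n)) : bool :=
  [&& hwalk u p, uniq (u :: unzip2 p) & uniq (unzip1 p)].

Definition hconnected : Prop :=
  forall u v : 'I_n, exists2 p, hpath u p & last u (unzip2 p) = v.

End Hypergraph.

Definition tensor (C : Type) (k n : nat) : Type := k.-tuple 'I_n -> C.

Section Tensor.
Variables (C : comNzRingType) (k n : nat).

(* A x^{k-1}: the index tuples (i_1, ..., i_k) with i_1 = i enumerate the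
   choices of (i_2, ..., i_k). *)
Definition tensor_app (A : tensor C k n) (x : 'cV[C]_n) : 'cV[C]_n :=
  \col_i \sum_(t : k.-tuple 'I_n | ohead t == Some i)
    A t * \prod_(j <- behead t) x j 0.

Definition hadamard_pow (x : 'cV[C]_n) (m : nat) : 'cV[C]_n :=
  \col_i x i 0 ^+ m.

Definition eigenpair (A : tensor C k n) (l : C) (x : 'cV[C]_n) : Prop :=
  x != 0 /\ tensor_app A x = l *: hadamard_pow x k.-1.

End Tensor.

Section Spectral.
Variables (R : realType) (n k : nat).

Definition tensor_eigenvalue (A : tensor R[i] k n) (l : R[i]) : Prop :=
  exists x, eigenpair A l x.

(* For 2 <= k and 0 < n, a tensor has finitely many eigenvalues and at least
   one, so that this supremum is a maximum. *)
Definition spectral_radius (A : tensor R[i] k n) : R :=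
  sup [set r : R | exists2 l, tensor_eigenvalue A l & r%:C = `|l|].

(* [set i in t] is the set of entries of t; it can only be an edge if the k
   entries of t are distinct. *)
Definition adjacency_tensor (G : hypergraph n k) : tensor R[i] k n :=
  fun t => if [set i in t]%SET \in edges G then ((k.-1)`!)%:R^-1 else 0.

Definition principal_eigenvector (G : hypergraph n k) (x : 'cV[R]_n) : Prop :=
  [/\ eigenpair (adjacency_tensor G)
        (spectral_radius (adjacency_tensor G))%:C
        (map_mx (real_complex R) x),
      forall i, 0 < x i 0
    & \sum_i x i 0 ^+ k = 1].

Definition max_entry (x : 'cV[R]_n) : R := sup (range (fun i => x i 0)).

Definition min_entry (x : 'cV[R]_n) : R := inf (range (fun i => x i 0)).

End Spectral.

(* Main.v *)
Require Import Defs.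
From HB Require Import structures.
From mathcomp Require Import all_boot all_order all_algebra.
From mathcomp Require Import all_classical all_reals all_analysis.
From mathcomp Require Import complex.

Import Order.TTheory GRing.Theory Num.Theory.
Local Open Scope ring_scope.

(** Let [l] be the spectral radius and [m], [M] the least and greatest entries
    of the principal eigenvector [x].  Collecting equal terms, the eigenvalue
    equation at a vertex [i] reads
      [l * x_i^(k-1) = \sum_(e containing i) \prod_(j in e minus i) x_j],
    because each edge [e] containing [i] comes from the [(k-1)!] index tuples,
    each of weight [1/(k-1)!], that start with [i] and then enumerate the rest
    of [e]
    ([tensor_app_adjacency], [principal_eigenvectorE]).  The right-hand side
    has [degree i] terms, each between [m^(k-1)] and [M^(k-1)].

    At a vertex of maximum degree [D] this gives [D m^(k-1) <= l M^(k-1)], and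
    at a vertex of minimum degree [d] it gives [l m^(k-1) <= d M^(k-1)].
    Multiplying the two and cancelling [l > 0] yields
      [D m^(2(k-1)) <= d M^(2(k-1))]   ([max_degree_min_degree_ratio]),
    which says that [(m/M)^k <= (d/D)^a] and [(D/d)^a <= (M/m)^k] for the
    exponent [a = k / (2(k-1))] of the theorem.

    Finally the normalisation [\sum_i x_i^k = 1] is estimated by keeping one
    extremal entry and bounding the [n-1] others by the opposite extremum:
      [1 <= m^k + (n-1) M^k <= M^k ((d/D)^a + n - 1)]  and
      [1 >= M^k + (n-1) m^k >= m^k ((D/d)^a + n - 1)].
    Taking [k]-th roots gives the two claims. *)

(** * The adjacency tensor as a sum over edges *)

(** Removing the head identifies these tuples with the injective enumerations
    of [e :\ i], a set of [k - 1] elements. *)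
Lemma card_rooted_enumerations (T : finType) (k : nat) (e : {set T}) (i : T) :
  #|e| = k -> i \in e ->
  #|[pred t : k.-tuple T | (ohead t == Some i) && ([set j in t]%SET == e)]|
    = (k.-1)`!.
Proof.
move=> ek ie; have e1k : #|e :\ i| = k.-1 by rewrite -ek (cardsD1 i e) ie.
case: k ek e1k => [|k] ek e1k.
  by move: ie; rewrite (cards0_eq ek) inE.
have -> : (k.+1.-1)`! = #|e :\ i| ^_ k by rewrite e1k ffactnn.
rewrite -card_uniq_tuples.
rewrite -(card_imset _ (f := fun t : k.-tuple T => cons_tuple i t)); last first.
  by move=> s t /(congr1 val) /= [] /val_inj.
apply: eq_card => t; rewrite inE /=; apply/idP/imsetP.
- case/tupleP: t => j t /= /andP[/eqP[->] /eqP te].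
  have uit : uniq (i :: t).
    by apply/card_uniqP; rewrite /= size_tuple -ek -te cardsE.
  case/andP: uit => it ut; exists t => //; rewrite inE; apply/andP; split => //.
  apply/allP => h ht; change (h \in e :\ i); rewrite -te !inE ht orbT andbT.
  by apply: contraNneq it => <-.
- case=> s; rewrite inE => /andP[/allP sei us] ->; rewrite /= eqxx /=.
  have se j : j \in s -> j \in e :\ i := sei j.
  have is' : i \notin s by apply/negP => /se; rewrite !inE eqxx.
  rewrite eqEcard; apply/andP; split.
    apply/fintype.subsetP => j; rewrite !inE => /predU1P[->//|/se].
    by rewrite !inE => /andP[].
  rewrite ek cardsE (card_uniqP _) ?size_tuple //.
  by rewrite /= is'.
Qed.

Lemma prod_rooted_enumeration (C : comNzRingType) (T : finType) (k : nat)
    (t : k.-tuple T) (i : T) (F : T -> C) :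
  #|[set j in t]%SET| = k -> ohead t = Some i ->
  \prod_(j <- behead t) F j = \prod_(j in [set j in t]%SET :\ i) F j.
Proof.
case: k t => [|k] t; first by rewrite tuple0.
case/tupleP: t => j t /= tk [ji]; subst j.
have : uniq (i :: t) by apply/card_uniqP; rewrite /= size_tuple -[RHS]tk cardsE.
case/andP=> it ut; rewrite -big_enum; apply/perm_big/uniq_perm => //.
  exact: enum_uniq.
move=> j; rewrite mem_enum !inE; case: eqVneq => [->|] //=.
exact: negbTE.
Qed.

(** The weight [1/(k-1)!] cancels the number of index tuples that start with
    [i] and enumerate a given edge. *)
Lemma tensor_app_adjacency (R : realType) (n k : nat) (G : hypergraph n k)
    (x : 'cV[R[i]]_n) (i : 'I_n) :
  tensor_app (adjacency_tensor R G) x i 0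
    = \sum_(e in edges G | i \in e) \prod_(j in e :\ i) x j 0.
Proof.
rewrite mxE /adjacency_tensor.
rewrite (bigID (fun t : k.-tuple 'I_n => [set j in t]%SET \in edges G)) /=.
rewrite [X in _ + X]big1 ?addr0; last first.
  by move=> t /andP[_ /negbTE ->]; rewrite mul0r.
rewrite (partition_big (fun t : k.-tuple 'I_n => [set j in t]%SET)
  (fun e => (e \in edges G) && (i \in e))) /=; last first.
  case=> -[//|j s] ts /andP[/eqP[<-] -> /=].
  by rewrite inE mem_head.
apply: eq_bigr => e /andP[eG ie]; have ek := edges_uniform eG.
rewrite (eq_bigl [pred t : k.-tuple 'I_n |
    (ohead t == Some i) && ([set j in t]%SET == e)]); last first.
  move=> t /=; case: (_ == e) / eqP => [->|_]; last by rewrite !andbF.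
  by rewrite eG !andbT.
rewrite (eq_bigr (fun=> (k.-1)`!%:R^-1 * \prod_(j in e :\ i) x j 0)).
  rewrite sumr_const card_rooted_enumerations // -[LHS]mulr_natl mulrA divff.
    by rewrite mul1r.
  by rewrite pnatr_eq0 -lt0n fact_gt0.
move=> t /andP[/eqP ti /eqP te]; rewrite te eG; congr (_ * _).
subst e; exact: prod_rooted_enumeration ek ti.
Qed.

Lemma principal_eigenvectorE (R : realType) (n k : nat) (G : hypergraph n k)
    (x : 'cV[R]_n) (i : 'I_n) :
  principal_eigenvector G x ->
  spectral_radius (adjacency_tensor R G) * x i 0 ^+ k.-1
    = \sum_(e in edges G | i \in e) \prod_(j in e :\ i) x j 0.
Proof.
case=> -[_ /matrixP/(_ i 0)]; rewrite tensor_app_adjacency !mxE => H _ _.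
apply: complexI; rewrite rmorphM rmorphXn /= -H rmorph_sum.
by apply: eq_bigr => e _; rewrite rmorph_prod; apply: eq_bigr => j _; rewrite mxE.
Qed.

(** * Degrees and extremal entries *)

Lemma degree_sum_bounds (R : realType) (n k : nat) (G : hypergraph n k)
    (x : 'cV[R]_n) (m M : R) (i : 'I_n) :
  0 <= m -> (forall j, m <= x j 0 <= M) ->
  (degree G i)%:R * m ^+ k.-1
    <= \sum_(e in edges G | i \in e) \prod_(j in e :\ i) x j 0
    <= (degree G i)%:R * M ^+ k.-1.
Proof.
move=> m0 mxM.
have const_sum c : (degree G i)%:R * c ^+ k.-1
    = \sum_(e in edges G | i \in e) \prod_(j in e :\ i) c.
  rewrite (eq_bigr (fun=> c ^+ k.-1)); last first.
    move=> e /andP[eG ie]; rewrite prodr_const; congr (_ ^+ _).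
    by rewrite -(edges_uniform eG) (cardsD1 i e) ie.
  by rewrite sumr_const mulr_natl; congr (_ *+ _); apply: eq_card => e; rewrite !inE.
rewrite !const_sum; apply/andP; split; apply: ler_sum => e _;
  apply: ler_prod => j _; have /andP[mx xM] := mxM j.
  by rewrite m0.
by rewrite xM (le_trans m0).
Qed.

Lemma max_degree_attained {n k : nat} (G : hypergraph n k) :
  (0 < n)%N -> exists i, max_degree G = degree G i.
Proof.
by move=> n0; case: (bigop.eq_bigmax (degree G)); rewrite ?card_ord // => i; exists i.
Qed.

(** The iterated minimum starts from the number of edges, which already bounds
    the degree of any vertex. *)
Lemma exists_degree_le_min_degree {n k : nat} (G : hypergraph n k) :
  (0 < n)%N -> exists i, (degree G i <= min_degree G)%N.
Proof.
move=> n0; rewrite /min_degree.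
elim/big_ind: _ => [|a b [i ia] [j jb]|i _]; last by exists i.
  exists (Ordinal n0); apply/subset_leq_card/fintype.subsetP => e.
  by rewrite inE => /andP[].
by case: (leqP a b) => _; [exists i | exists j].
Qed.

Section Principal.
Variables (R : realType) (n k : nat) (G : hypergraph n k) (x : 'cV[R]_n).
Hypotheses (hk : (2 <= k)%N) (hE : edges G != finset.set0).
Hypothesis hx : principal_eigenvector G x.

Let l := spectral_radius (adjacency_tensor R G).

Lemma principal_gt0 i : 0 < x i 0.
Proof. by case: hx. Qed.

Lemma num_vertices_gt0 : (0 < n)%N.
Proof.
case/set0Pn: hE => e eG; have := edges_uniform eG.
case: (posnP n) => // n0 ek; have := max_card (mem e).
by rewrite card_ord ek n0 leqNgt (ltn_trans _ hk).
Qed.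

(** At a vertex of an edge, the eigenvalue equation has a positive right-hand
    side. *)
Lemma spectral_radius_gt0 : 0 < l.
Proof.
case/set0Pn: hE => e eG.
have /card_gt0P[i ie] : (0 < #|e|)%N.
  by rewrite (edges_uniform eG) (ltn_trans _ hk).
rewrite -(pmulr_lgt0 _ (exprn_gt0 k.-1 (principal_gt0 i))).
rewrite principal_eigenvectorE // (bigD1 e) ?eG //=.
apply: ltr_wpDr; last by apply: prodr_gt0 => j _; exact: principal_gt0.
by apply: sumr_ge0 => f _; apply: prodr_ge0 => j _; apply/ltW/principal_gt0.
Qed.

(** A vertex in no edge would turn the eigenvalue equation into
    [l * x_i^(k-1) = 0]. *)
Lemma degree_gt0 i : (0 < degree G i)%N.
Proof.
rewrite lt0n; apply/negP => /eqP /cards0_eq di0.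
have := mulr_gt0 spectral_radius_gt0 (exprn_gt0 k.-1 (principal_gt0 i)).
rewrite principal_eigenvectorE // big_pred0 ?ltxx // => e.
by move/setP: di0 => /(_ e); rewrite !inE.
Qed.

Lemma max_degree_gt0 : (0 < max_degree G)%N.
Proof. by have [i ->] := max_degree_attained G num_vertices_gt0; exact: degree_gt0. Qed.

Lemma min_degree_gt0 : (0 < min_degree G)%N.
Proof.
have [i ile] := exists_degree_le_min_degree G num_vertices_gt0.
exact: leq_trans (degree_gt0 i) ile.
Qed.

(** The spectral radius is bounded below at a vertex [p] of maximum degree and
    above at a vertex [q] of minimum degree; it cancels from the product. *)
Lemma max_degree_min_degree_ratio (m M : R) :
  0 < m -> (forall j, m <= x j 0 <= M) ->
  (max_degree G)%:R * m ^+ (2 * k.-1) <= (min_degree G)%:R * M ^+ (2 * k.-1).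
Proof.
move=> m0 mxM; have l0 := spectral_radius_gt0.
have [p ->] := max_degree_attained G num_vertices_gt0.
have [q qd] := exists_degree_le_min_degree G num_vertices_gt0.
have M0 : 0 < M by case/andP: (mxM p) => mp /(le_trans mp); exact: lt_le_trans.
have upper : (degree G p)%:R * m ^+ k.-1 <= l * M ^+ k.-1.
  have /andP[+ _] := degree_sum_bounds _ _ _ G _ _ _ p (ltW m0) mxM.
  rewrite -principal_eigenvectorE // => /le_trans; apply.
  rewrite ler_pM2l // lerXn2r ?nnegrE ?(ltW M0) ?(ltW (principal_gt0 p)) //.
  by case/andP: (mxM p).
have lower : l * m ^+ k.-1 <= (min_degree G)%:R * M ^+ k.-1.
  have /andP[_ H] := degree_sum_bounds _ _ _ G _ _ _ q (ltW m0) mxM.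
  apply: (@le_trans _ _ ((degree G q)%:R * M ^+ k.-1)); last first.
    by rewrite ler_pM2r ?exprn_gt0 // ler_nat.
  apply: le_trans H; rewrite -principal_eigenvectorE //.
  rewrite ler_pM2l // lerXn2r ?nnegrE ?(ltW m0) ?(ltW (principal_gt0 q)) //.
  by case/andP: (mxM q).
rewrite -(ler_pM2l l0) mulnC !exprM !expr2.
have mk0 : 0 <= m ^+ k.-1 by rewrite exprn_ge0 ?ltW.
have := ler_pM (mulr_ge0 (ler0n R _) mk0) (mulr_ge0 (ltW l0) mk0) upper lower.
by rewrite mulrACA [X in _ <= X]mulrACA [_ * l]mulrC !mulrA.
Qed.

End Principal.

(** * Extracting roots *)

(** [k / (2(k-1))] is the exponent that turns the [2(k-1)]-th powers of
    [max_degree_min_degree_ratio] into [k]-th powers. *)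
Lemma powR_exprn_exponent (R : realType) (k : nat) (v : R) :
  (2 <= k)%N -> 0 <= v ->
  (v ^+ (2 * k.-1)) `^ (k%:R / (2 * (k%:R - 1))) = v ^+ k.
Proof.
move=> hk v0; rewrite -!powR_mulrn // -powRrM; congr (_ `^ _).
case: k hk => [//|[//|k]] _ /=.
have -> : k.+2%:R - 1 = k.+1%:R :> R by rewrite -natr1 addrK.
by rewrite natrM mulrC divfK.
Qed.

Lemma powR_inv_natE (R : realType) (k : nat) (M : R) :
  (0 < k)%N -> 0 <= M -> (M ^+ k) `^ (k%:R^-1) = M.
Proof.
by move=> k0 M0; rewrite -powR_mulrn // -powRrM mulfV ?powRr1 // pnatr_eq0 -lt0n.
Qed.

Lemma powR_invn_le (R : realType) (k : nat) (b M : R) :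
  (0 < k)%N -> 0 < b -> 0 <= M -> 1 <= M ^+ k * b -> b `^ (- k%:R^-1) <= M.
Proof.
move=> k0 b0 M0 H; rewrite powRN -[leRHS](powR_inv_natE _ k) //.
have bk0 : 0 < b `^ k%:R^-1 by exact: powR_gt0.
rewrite -(ler_pM2r bk0) mulVf ?gt_eqF // -powRM ?exprn_ge0 ?(ltW b0) //.
have e1 : 1 `^ k%:R^-1 = 1 :> R by rewrite powR1.
rewrite -[leLHS]e1; apply: ge0_ler_powR => //; rewrite ?nnegrE ?invr_ge0 //.
by rewrite mulr_ge0 ?exprn_ge0 // ltW.
Qed.

Lemma powR_invn_ge (R : realType) (k : nat) (b m : R) :
  (0 < k)%N -> 0 < b -> 0 <= m -> m ^+ k * b <= 1 -> m <= b `^ (- k%:R^-1).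
Proof.
move=> k0 b0 m0 H; rewrite powRN -[leLHS](powR_inv_natE _ k) //.
have bk0 : 0 < b `^ k%:R^-1 by exact: powR_gt0.
rewrite -(ler_pM2r bk0) mulVf ?gt_eqF // -powRM ?exprn_ge0 ?(ltW b0) //.
have e1 : 1 `^ k%:R^-1 = 1 :> R by rewrite powR1.
rewrite -[leRHS]e1; apply: ge0_ler_powR => //; rewrite ?nnegrE ?invr_ge0 //.
by rewrite mulr_ge0 ?exprn_ge0 // ltW.
Qed.

(** * Bounds on the extremal entries *)

Theorem theorem2p2 (R : realType) (n k : nat) (G : hypergraph n k)
    (x : 'cV[R]_n) (hk : (2 <= k)%N) (hG : hconnected G)
    (hE : edges G != finset.set0) (hx : principal_eigenvector G x) :
  let D : R := (max_degree G)%:R in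
  let d : R := (min_degree G)%:R in
  let a : R := k%:R / (2 * (k%:R - 1)) in
  ((d / D) `^ a + n%:R - 1) `^ (- k%:R^-1) <= max_entry x
  /\
  min_entry x <= ((D / d) `^ a + n%:R - 1) `^ (- k%:R^-1).
Proof.
move=> D d a; have n0 := num_vertices_gt0 _ _ G hk hE.
have k0 : (0 < k)%N by exact: ltn_trans hk.
have D0 : 0 < D by rewrite ltr0n (max_degree_gt0 R _ _ G x).
have d0 : 0 < d by rewrite ltr0n (min_degree_gt0 R _ _ G x).
have a0 : 0 <= a.
  by rewrite divr_ge0 // mulr_ge0 // subr_ge0 ler1n.
have x0 := principal_gt0 _ _ _ _ _ hx; have [_ _ x1] := hx.
case: (@arg_minP _ _ _ (Ordinal n0) xpredT (fun i => x i 0) isT) => p _ xp.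
case: (@arg_maxP _ _ _ (Ordinal n0) xpredT (fun i => x i 0) isT) => q _ xq.
pose m := x p 0; pose M := x q 0.
have mx j : m <= x j 0 by exact: xp.
have xM j : x j 0 <= M by exact: xq.
have m0 : 0 < m by exact: x0.
have M0 : 0 < M by exact: x0.
have mxM j : m <= x j 0 <= M by rewrite mx xM.
have ratio := max_degree_min_degree_ratio _ _ _ _ _ hk hE hx _ _ m0 mxM.
have n1 : 0 <= n%:R - 1 :> R by rewrite subr_ge0 ler1n.
have others (i : 'I_n) (c : R) : \sum_(j < n | j != i) c = (n%:R - 1) * c.
  rewrite sumr_const -[LHS]mulr_natl; congr (_ * _).
  by rewrite cardC1 card_ord -subn1 natrB.
have upper : 1 <= m ^+ k + (n%:R - 1) * M ^+ k.
  (* [p] attains the minimum [m]: its term is kept exactly. *)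
  rewrite -[leLHS]x1 (bigD1 p) //= lerD2l -(others p); apply: ler_sum => j _.
  by rewrite lerXn2r ?nnegrE ?xM ?ltW.
have lower : M ^+ k + (n%:R - 1) * m ^+ k <= 1.
  rewrite -[leRHS]x1 (bigD1 q) //= lerD2l -(others q); apply: ler_sum => j _.
  by rewrite lerXn2r ?nnegrE ?mx ?ltW.
have mM0 : 0 <= m / M by rewrite divr_ge0 ?ltW.
have Mm0 : 0 <= M / m by rewrite divr_ge0 ?ltW.
have small : (m / M) ^+ k <= (d / D) `^ a.
  rewrite -(powR_exprn_exponent _ _ _ hk) //.
  apply: (ge0_ler_powR a0); rewrite ?nnegrE ?exprn_ge0 //.
    by rewrite divr_ge0.
  by rewrite expr_div_n ler_pdivrMr ?exprn_gt0 // mulrAC ler_pdivlMr // mulrC.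
have large : (D / d) `^ a <= (M / m) ^+ k.
  rewrite -(powR_exprn_exponent _ _ _ hk) //.
  apply: (ge0_ler_powR a0); rewrite ?nnegrE ?exprn_ge0 //.
    by rewrite divr_ge0.
  by rewrite expr_div_n ler_pdivlMr ?exprn_gt0 // mulrAC ler_pdivrMr // [leRHS]mulrC.
split.
- apply: (@le_trans _ _ M); last first.
    apply: ub_le_sup; last by exists q.
    by exists M => _ [j _ <-]; exact: xM.
  apply: powR_invn_le => //; [|exact: ltW|].
    by rewrite -addrA ltr_wpDr // powR_gt0 // divr_gt0.
  apply: (le_trans upper); rewrite -addrA mulrDr [M ^+ k * (_ - _)]mulrC lerD2r.
  by rewrite mulrC -ler_pdivrMr ?exprn_gt0 // -expr_div_n.
- apply: (@le_trans _ _ m).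
    apply: ge_inf; last by exists p.
    by exists m => _ [j _ <-]; exact: mx.
  apply: powR_invn_ge => //; [|exact: ltW|].
    by rewrite -addrA ltr_wpDr // powR_gt0 // divr_gt0.
  apply: le_trans lower; rewrite -addrA mulrDr [m ^+ k * (_ - _)]mulrC lerD2r.
  by rewrite mulrC -ler_pdivlMr ?exprn_gt0 // -expr_div_n.
Qed.
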